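(* Let $k \ge 1$, $m = 4k+5$, $\theta = 2\pi/m$, and let $P$ be a finite point set in general position. For any two vertices $u, w \in P$, let $M$ be the midpoint of the side of $T_{uw}$ opposite $u$ and let $\alpha$ be the unsigned angle between $uw$ and $uM$. Then the $\theta_m$-graph on $P$ contains a path from $u$ to $w$ of length at most $$\left(\frac{\cos\alpha}{\cos(\theta/2)} + \frac{(\cos\alpha\tan(\theta/2) + \sin\alpha)\cos(\theta/4)}{\cos(\theta/2) - \sin(3\theta/4)}\right)|uw|.$$
   Context: Cones: for $m \ge 2$, $\theta = 2\pi/m$; around each point $u$ draw $m$ rays with consecutive angular separation $\theta$, oriented so the vertical upward ray from $u$ bisects a cone $C_0^u$; cones numbered $C_0^u,\dots,C_{m-1}^u$ clockwise, same orientation at every point. General position: no two points on a line parallel to a cone boundary ray, no two on a line perpendicular to a cone bisector, no three collinear. The $\theta_m$-graph on $P$: for each $u\in P$ and each cone $C_i^u$ containing another point of $P$, add an edge from $u$ to the point of $C_i^u$ whose orthogonal projection onto the bisector of $C_i^u$ is closest to $u$; edges weighted by Euclidean length. Canonical triangle: if $w$ lies in cone $C$ of $u$, $T_{uw}$ is the triangle bounded by the two boundary rays of $C$ and the line through $w$ perpendicular to the bisector of $C$. *)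

(* Defs.v *)
From Stdlib Require Import Reals Lra List.
Open Scope R_scope.

Definition point : Type := (R * R)%type.

Definition dot (p q : point) : R := fst p * fst q + snd p * snd q.
Definition cross (p q : point) : R := fst p * snd q - snd p * fst q.
Definition vsub (p q : point) : point := (fst p - fst q, snd p - snd q).
Definition edist (p q : point) : R := sqrt (dot (vsub p q) (vsub p q)).

Definition theta (m : nat) : R := 2 * PI / INR m.

(* Unit direction of the bisector of cone C_i (cones numbered clockwise,
   C_0 bisected by the upward vertical ray): angle pi/2 - i*theta. *)
Definition bisector (m i : nat) : point :=
  (cos (PI / 2 - INR i * theta m), sin (PI / 2 - INR i * theta m)).

(* Unit direction of the cone boundary rays: angles pi/2 - theta/2 - i*theta
   (i = 0..m-1 enumerates all m rays). *)
Definition boundary_ray (m i : nat) : point :=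
  (cos (PI / 2 - theta m / 2 - INR i * theta m),
   sin (PI / 2 - theta m / 2 - INR i * theta m)).

(* v lies (strictly) inside cone C_i of u: the angle between v - u and the
   bisector of C_i is less than theta/2. *)
Definition in_cone (m : nat) (u : point) (i : nat) (v : point) : Prop :=
  dot (vsub v u) (bisector m i) > edist u v * cos (theta m / 2).

Definition proj (m : nat) (u : point) (i : nat) (v : point) : R :=
  dot (vsub v u) (bisector m i).

Definition theta_edge (m : nat) (P : list point) (u v : point) : Prop :=
  In u P /\ In v P /\
  exists i : nat, (i < m)%nat /\ in_cone m u i v /\
    forall x, In x P -> in_cone m u i x -> proj m u i v <= proj m u i x.

Definition theta_adj (m : nat) (P : list point) (u v : point) : Prop :=
  theta_edge m P u v \/ theta_edge m P v u.

Fixpoint is_walk (m : nat) (P : list point) (l : list point) : Prop :=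
  match l with
  | nil => True
  | x :: l' =>
      match l' with
      | nil => True
      | y :: _ => theta_adj m P x y /\ is_walk m P l'
      end
  end.

Fixpoint walk_length (l : list point) : R :=
  match l with
  | nil => 0
  | x :: l' =>
      match l' with
      | nil => 0
      | y :: _ => edist x y + walk_length l'
      end
  end.

Definition general_position (m : nat) (P : list point) : Prop :=
  (forall p q, In p P -> In q P -> p <> q ->
     forall i, (i < m)%nat ->
       cross (vsub q p) (boundary_ray m i) <> 0 /\
       dot (vsub q p) (bisector m i) <> 0) /\
  (forall p q r, In p P -> In q P -> In r P -> p <> q -> p <> r -> q <> r ->
     cross (vsub q p) (vsub r p) <> 0).

Definition vangle (a b : point) : R :=
  acos (dot a b / (sqrt (dot a a) * sqrt (dot b b))).

(* Midpoint M of the side of the canonical triangle T_uw opposite u, when w lies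
   in cone C_i of u.  That side lies on the line through w perpendicular to the
   bisector of C_i and is cut symmetrically by the two boundary rays, so its
   midpoint is the point of the bisector ray at distance proj from u. *)
Definition canon_mid (m : nat) (u : point) (i : nat) (w : point) : point :=
  (fst u + proj m u i w * fst (bisector m i),
   snd u + proj m u i w * snd (bisector m i)).

Definition alpha_angle (m : nat) (u : point) (i : nat) (w : point) : R :=
  vangle (vsub w u) (vsub (canon_mid m u i w) u).

Definition stretch_factor (m : nat) (a : R) : R :=
  cos a / cos (theta m / 2) +
  (cos a * tan (theta m / 2) + sin a) * cos (theta m / 4) /
    (cos (theta m / 2) - sin (3 * theta m / 4)).

(* Main.v *)
Require Import Defs.
From Stdlib Require Import Reals List Arith Lra Lia.
Open Scope R_scope.

(** The stretch factor times [|uw|] is the piecewise linear potential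
    [A y + c |x|], where [y] and [x] are the coordinates of [w - u] along and
    across the bisector of the cone of [w].  Greedy routing proves the bound: from
    [u] move to the neighbour [v] in the cone that contains [w].  As [v - u] lies in
    the cone, [|uv| <= A y - c |x|] for it, so the potential measured from [v] in the
    axes of the old cone has dropped by at least [|uv|].  It remains to see that
    passing to the cone of [v] that contains [w] does not increase the potential:
    if [w - v] makes angles [f <= pi/2] and [g] with the old and the new bisector,
    then [g <= f] and [f + g <= pi/2 + theta/4] because [m = 4k+5], and [c] is chosen
    so that [A cos g + c sin g <= A cos f + c sin f] with equality at
    [f = pi/2], [g = theta/4]. *)

(** * The two coefficients of the potential and their trigonometry *)

Definition coef_c (t : R) : R :=
  cos (t / 4) / (cos (t / 2) - sin (3 * t / 4)).

(** On a cone boundary, where [|x| = y tan (t / 2)], the quantity [A y - c |x|] is then exactly the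
    length [y / cos (t / 2)]. *)
Definition coef_A (t : R) : R := / cos (t / 2) + coef_c t * tan (t / 2).

(** Since [cos (t / 2) = sin (PI / 2 - t / 2)], the bound [t < 2 * PI / 5] is just
    [3 * t / 4 < PI / 2 - t / 2]. *)
Lemma sin_lt_cos_half (t : R) :
  0 < t -> t < 2 * PI / 5 -> 0 < cos (t / 2) - sin (3 * t / 4).
Proof.
  intros Ht Ht5. pose proof PI_RGT_0.
  rewrite <- sin_shift.
  assert (sin (3 * t / 4) < sin (PI / 2 - t / 2)); [|lra].
  apply sin_increasing_1; lra.
Qed.

Lemma coef_c_pos (t : R) : 0 < t -> t < 2 * PI / 5 -> 0 < coef_c t.
Proof.
  intros Ht Ht5. pose proof PI_RGT_0.
  apply Rdiv_lt_0_compat; [apply cos_gt_0; lra | now apply sin_lt_cos_half].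
Qed.

Lemma coef_A_pos (t : R) : 0 < t -> t < 2 * PI / 5 -> 0 < coef_A t.
Proof.
  intros Ht Ht5. pose proof PI_RGT_0.
  pose proof (coef_c_pos t Ht Ht5).
  assert (0 < / cos (t / 2)) by (apply Rinv_0_lt_compat, cos_gt_0; lra).
  assert (0 < tan (t / 2)) by (apply tan_gt_0; lra).
  unfold coef_A. nra.
Qed.

(** The product form separates the sign of the half-difference from a factor that depends on the
    half-sum only. *)
Lemma harmonic_diff (A c f g : R) :
  (A * cos f + c * sin f) - (A * cos g + c * sin g) =
  2 * sin ((f - g) / 2) * (c * cos ((f + g) / 2) - A * sin ((f + g) / 2)).
Proof.
  assert (Hf : f = (f + g) / 2 + (f - g) / 2) by field.
  assert (Hg : g = (f + g) / 2 - (f - g) / 2) by field.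
  remember ((f + g) / 2) as p. remember ((f - g) / 2) as q.
  rewrite Hf, Hg, cos_plus, sin_plus, cos_minus, sin_minus. ring.
Qed.

(** The extremal angles [PI / 2] and [t / 4] have half-sum [PI / 4 + t / 8]; equality of the
    potential there makes the second factor of [harmonic_diff] vanish. *)
Lemma coef_eq (t : R) :
  0 < t -> t < 2 * PI / 5 ->
  coef_c t * cos (PI / 4 + t / 8) = coef_A t * sin (PI / 4 + t / 8).
Proof.
  intros Ht Ht5. pose proof PI_RGT_0.
  pose proof (sin_lt_cos_half t Ht Ht5) as Hd.
  assert (Hc : 0 < cos (t / 2)) by (apply cos_gt_0; lra).
  (* Multiplied by [cos (t / 2)], this reads [c * (cos (t / 2) - sin (3 * t / 4)) = cos (t / 4)],
     which defines [coef_c]. *)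
  assert (HK : coef_A t * cos (PI / 2) + coef_c t * sin (PI / 2) =
               coef_A t * cos (t / 4) + coef_c t * sin (t / 4)).
  { rewrite cos_PI2, sin_PI2. unfold coef_A, coef_c, tan.
    replace (3 * t / 4) with (t / 2 + t / 4) in * by field.
    rewrite sin_plus in *. field. split; lra. }
  pose proof (harmonic_diff (coef_A t) (coef_c t) (PI / 2) (t / 4)) as HD.
  replace ((PI / 2 + t / 4) / 2) with (PI / 4 + t / 8) in HD by field.
  assert (0 < sin ((PI / 2 - t / 4) / 2)) by (apply sin_gt_0; lra).
  nra.
Qed.

(** As the half-sum grows, its cosine falls and its sine rises, so up to [PI / 4 + t / 8] the second
    factor of [harmonic_diff] stays above its zero there. *)
Lemma harmonic_le (t f g : R) :
  0 < t -> t < 2 * PI / 5 -> 0 <= g -> g <= f -> f + g <= PI / 2 + t / 4 ->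
  coef_A t * cos g + coef_c t * sin g <= coef_A t * cos f + coef_c t * sin f.
Proof.
  intros Ht Ht5 Hg Hgf Hfg. pose proof PI_RGT_0.
  pose proof (coef_c_pos t Ht Ht5). pose proof (coef_A_pos t Ht Ht5).
  pose proof (coef_eq t Ht Ht5) as E.
  assert (0 <= sin ((f - g) / 2)) by (apply sin_ge_0; lra).
  assert (cos (PI / 4 + t / 8) <= cos ((f + g) / 2)) by (apply cos_decr_1; lra).
  assert (sin ((f + g) / 2) <= sin (PI / 4 + t / 8)) by (apply sin_incr_1; lra).
  pose proof (harmonic_diff (coef_A t) (coef_c t) f g) as HD.
  assert (0 <= coef_c t * cos ((f + g) / 2) - coef_A t * sin ((f + g) / 2)) by nra.
  nra.
Qed.

(** * Turning by multiples of the cone angle *)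

Lemma theta_mul (m : nat) : (0 < m)%nat -> INR m * theta m = 2 * PI.
Proof.
  intros H. unfold theta. field. apply not_0_INR. lia.
Qed.

Lemma theta_eq (k : nat) : (4 * INR k + 5) * theta (4 * k + 5) = 2 * PI.
Proof.
  rewrite <- (theta_mul (4 * k + 5)) by lia.
  rewrite plus_INR, mult_INR. simpl. ring.
Qed.

Lemma theta_bounds (k : nat) :
  (1 <= k)%nat -> 0 < theta (4 * k + 5) /\ theta (4 * k + 5) < 2 * PI / 5.
Proof.
  intros Hk. pose proof PI_RGT_0. pose proof (theta_eq k).
  apply le_INR in Hk. simpl in Hk. split; nra.
Qed.

(** Here [n] counts the cones between the old and new bisectors and [s] is the deviation from the
    new one; [harmonic_le] applies with [f = n t + s] and [g = |s|]. *)
Lemma turn_le (k n : nat) (s : R) :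
  let t := theta (4 * k + 5) in
  (1 <= k)%nat -> (n <= 2 * k + 2)%nat -> - (t / 2) <= s <= t / 2 ->
  0 <= cos (INR n * t + s) ->
  coef_A t * cos s + coef_c t * Rabs (sin s) <=
  coef_A t * cos (INR n * t + s) + coef_c t * Rabs (sin (INR n * t + s)).
Proof.
  intros t Hk Hn Hs Hcos. pose proof PI_RGT_0.
  destruct (theta_bounds k Hk) as [Ht Ht5]. pose proof (theta_eq k) as E.
  fold t in Ht, Ht5, E.
  destruct n as [|n']; [simpl; rewrite Rmult_0_l, Rplus_0_l; lra|].
  set (n := S n') in *.
  assert (Hn1 : 1 <= INR n) by (change 1 with (INR 1); apply le_INR; lia).
  clearbody n. apply le_INR in Hn. rewrite plus_INR, mult_INR in Hn. change (INR 2) with 2 in Hn.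
  clearbody t.
  (* The angle is at most [(2k + 2) t + t / 2 = PI], so a nonnegative cosine confines it to
     [PI / 2]. *)
  assert (INR n * t <= (2 * INR k + 2) * t) by (apply Rmult_le_compat_r; lra).
  assert (1 * t <= INR n * t) by (apply Rmult_le_compat_r; lra).
  assert (Hf1 : INR n * t + s <= PI) by lra.
  assert (Hf0 : t / 2 <= INR n * t + s) by lra.
  assert (Hf : INR n * t + s <= PI / 2).
  { apply Rnot_lt_le. intros Hlt.
    assert (cos (INR n * t + s) < 0) by (apply cos_lt_0; lra). lra. }
  assert (Habs : coef_A t * cos s + coef_c t * Rabs (sin s) =
                 coef_A t * cos (Rabs s) + coef_c t * sin (Rabs s)).
  { unfold Rabs at 2 3. destruct (Rcase_abs s).
    - rewrite cos_neg, sin_neg, Rabs_left1; [lra|].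
      assert (0 <= sin (- s)) by (apply sin_ge_0; lra).
      rewrite sin_neg in *. lra.
    - rewrite Rabs_right; [lra|]. apply Rle_ge, sin_ge_0; lra. }
  rewrite Habs, (Rabs_right (sin (INR n * t + s)))
    by (apply Rle_ge, sin_ge_0; lra).
  (* Since [PI / 2 = (k + 5/4) t] and [s >= - t / 2], the integer [n] is at most [k + 7/4]. *)
  assert (Hnk : INR n <= INR k + 1).
  { assert (n < k + 2)%nat.
    { apply INR_lt. rewrite plus_INR. change (INR 2) with 2. nra. }
    replace (INR k + 1) with (INR (k + 1)) by (rewrite plus_INR; simpl; ring).
    apply le_INR. lia. }
  assert (INR n * t <= (INR k + 1) * t) by (apply Rmult_le_compat_r; lra).
  apply harmonic_le; auto using Rabs_pos; unfold Rabs; destruct (Rcase_abs s);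
    try lra.
  (* Left is [s >= 0]. For [n = k + 1], the bound [f <= PI / 2] leaves only [s <= t / 4]; for
     [n <= k], [n t + 2 s <= (k + 1) t < PI / 2]. *)
  assert (INR n = INR k + 1 \/ INR n * t <= INR k * t) as [En|]; [|nra|nra].
  destruct (Nat.eq_dec n (k + 1)) as [Hn'|Hne].
  - left. rewrite Hn', plus_INR. simpl. ring.
  - right. apply Rmult_le_compat_r; [lra|]. apply le_INR.
    assert (n <= k + 1)%nat; [|lia].
    apply INR_le. rewrite plus_INR. simpl. lra.
Qed.

(* Since [m] is odd, [i - j] is congruent modulo [m], up to sign, to some
   [n <= (m - 1) / 2]. *)
Lemma cone_change_angle (k i j : nat) (s : R) :
  let t := theta (4 * k + 5) in
  (i < 4 * k + 5)%nat -> (j < 4 * k + 5)%nat ->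
  exists n e, (n <= 2 * k + 2)%nat /\ (e = s \/ e = - s) /\
    cos ((INR i - INR j) * t + s) = cos (INR n * t + e) /\
    Rabs (sin ((INR i - INR j) * t + s)) = Rabs (sin (INR n * t + e)).
Proof.
  intros t Hi Hj. pose proof (theta_mul (4 * k + 5) ltac:(lia)) as E.
  fold t in E.
  assert (Hneg : forall a b, a = - b ->
    cos a = cos b /\ Rabs (sin a) = Rabs (sin b)).
  { intros a b ->. now rewrite cos_neg, sin_neg, Rabs_Ropp. }
  assert (Hper : forall a b, a = b + 2 * PI ->
    cos a = cos b /\ Rabs (sin a) = Rabs (sin b)).
  { intros a b ->. now rewrite cos_plus, sin_plus, cos_2PI, sin_2PI,
      !Rmult_0_r, !Rmult_1_r, Rplus_0_r, Rminus_0_r. }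
  destruct (le_lt_dec j i) as [Hji|Hji].
  - destruct (le_lt_dec (i - j) (2 * k + 2)).
    + exists (i - j)%nat, s. rewrite minus_INR by lia. auto.
    + exists (4 * k + 5 - (i - j))%nat, (- s).
      split; [lia|split; [now right|]].
      rewrite !minus_INR by lia.
      replace ((INR i - INR j) * t + s)
        with (- ((INR (4 * k + 5) - (INR i - INR j)) * t + - s) + 2 * PI) by lra.
      edestruct Hper as [-> ->]; [reflexivity|]. now apply Hneg.
  - destruct (le_lt_dec (j - i) (2 * k + 2)).
    + exists (j - i)%nat, (- s). split; [lia|split; [now right|]].
      rewrite minus_INR by lia. apply Hneg. ring.
    + exists (4 * k + 5 - (j - i))%nat, s.
      split; [lia|split; [now left|]].
      rewrite !minus_INR by lia.
      replace ((INR (4 * k + 5) - (INR j - INR i)) * t + s)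
        with (((INR i - INR j) * t + s) + 2 * PI) by lra.
      edestruct (Hper ((INR i - INR j) * t + s + 2 * PI)) as [-> ->]; auto.
Qed.

(** * Coordinates along a bisector, polar form and covering by cones *)

Definition norm (z : point) : R := sqrt (dot z z).

Definition potential (m i : nat) (z : point) : R :=
  coef_A (theta m) * dot z (bisector m i) +
  coef_c (theta m) * Rabs (cross z (bisector m i)).

Lemma bisector_unit (m i : nat) :
  fst (bisector m i) * fst (bisector m i) +
  snd (bisector m i) * snd (bisector m i) = 1.
Proof.
  unfold bisector; simpl.
  pose proof (sin2_cos2 (PI / 2 - INR i * theta m)) as H.
  unfold Rsqr in H. lra.
Qed.

Lemma norm_nonneg (z : point) : 0 <= norm z.
Proof. apply sqrt_pos. Qed.

Lemma norm_sqr (z : point) : norm z * norm z = dot z z.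
Proof. apply sqrt_sqrt. unfold dot. nra. Qed.

Lemma edist_norm (u v : point) : edist u v = norm (vsub v u).
Proof.
  unfold edist, norm, dot, vsub; simpl. f_equal. ring.
Qed.

Lemma edist_pos (u v : point) : u <> v -> 0 < edist u v.
Proof.
  intros H. apply sqrt_lt_R0. unfold dot, vsub; simpl.
  destruct u as [a b], v as [c d]; simpl.
  destruct (Req_dec a c), (Req_dec b d); [now subst|nra|nra|nra].
Qed.

Lemma dot_cross_sqr (m i : nat) (z : point) :
  dot z (bisector m i) * dot z (bisector m i) +
  cross z (bisector m i) * cross z (bisector m i) = norm z * norm z.
Proof.
  rewrite norm_sqr. pose proof (bisector_unit m i) as H.
  unfold dot, cross.
  replace (fst z * fst z + snd z * snd z) with
    ((fst z * fst z + snd z * snd z) * 1) by ring.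
  rewrite <- H. ring.
Qed.

(** The angle is [acos] of the normalised first coordinate, negated in the lower half-plane. *)
Lemma polar_form (z : point) :
  exists a, - PI <= a <= PI /\ fst z = norm z * cos a /\ snd z = norm z * sin a.
Proof.
  pose proof PI_RGT_0. pose proof (norm_nonneg z) as H0.
  pose proof (norm_sqr z) as H1. unfold dot in H1.
  destruct (Req_dec (norm z) 0) as [Hz|Hz].
  { exists 0. rewrite Hz in *. split; [lra|split; nra]. }
  assert (Hp : 0 < norm z) by lra.
  assert (Hx : -1 <= fst z / norm z <= 1).
  { split; [apply Rmult_le_reg_r with (norm z)|apply Rmult_le_reg_r with (norm z)];
      auto; unfold Rdiv; rewrite Rmult_assoc, Rinv_l by lra; nra. }
  pose proof (acos_bound (fst z / norm z)) as Hb.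
  assert (Hs : norm z * sin (acos (fst z / norm z)) = Rabs (snd z)).
  { apply Rsqr_inj.
    - apply Rmult_le_pos; [lra|apply sin_ge_0; lra].
    - apply Rabs_pos.
    - rewrite <- Rsqr_abs, Rsqr_mult, sin2, cos_acos by lra.
      unfold Rsqr.
      replace (norm z * norm z * (1 - fst z / norm z * (fst z / norm z)))
        with (norm z * norm z - fst z * fst z) by (field; lra). lra. }
  assert (Hc : norm z * cos (acos (fst z / norm z)) = fst z)
    by (rewrite cos_acos by lra; field; lra).
  destruct (Rle_lt_dec 0 (snd z)).
  - exists (acos (fst z / norm z)). rewrite Rabs_right in Hs by lra. lra.
  - exists (- acos (fst z / norm z)). rewrite cos_neg, sin_neg.
    rewrite Rabs_left in Hs by lra. lra.
Qed.

Lemma nat_ceil (m : nat) (x : R) :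
  0 < x <= INR m -> exists j, (j < m)%nat /\ INR j < x <= INR j + 1.
Proof.
  induction m as [|m IH]; intros Hx; [simpl in Hx; lra|].
  rewrite S_INR in Hx. destruct (Rle_lt_dec x (INR m)).
  - destruct IH as (j & Hj & Hjx); [lra|]. exists j. split; [lia|exact Hjx].
  - exists m. split; [lia|lra].
Qed.

(** Clockwise angles from the vertical can be taken in [(- theta / 2, 2 PI - theta / 2]], which [m]
    half-open sectors centred at the bisectors tile. *)
Lemma cone_cover (m : nat) (z : point) :
  (0 < m)%nat ->
  exists j s, (j < m)%nat /\ - (theta m / 2) < s <= theta m / 2 /\
    fst z = norm z * cos (PI / 2 - INR j * theta m - s) /\
    snd z = norm z * sin (PI / 2 - INR j * theta m - s).
Proof.
  intros Hm. pose proof PI_RGT_0. pose proof (theta_mul m Hm) as E.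
  assert (Hm0 : 0 < INR m) by (apply lt_0_INR; lia).
  assert (Ht : 0 < theta m) by nra.
  assert (Hm1 : 1 <= INR m) by (change 1 with (INR 1); apply le_INR; lia).
  assert (theta m <= 2 * PI) by nra.
  destruct (polar_form z) as (a & Ha & Hc & Hs).
  assert (Hb : exists b, - (theta m / 2) < b <= 2 * PI - theta m / 2 /\
            cos (PI / 2 - b) = cos a /\ sin (PI / 2 - b) = sin a).
  (* [PI / 2 - a] lies in [[- PI / 2, 3 PI / 2]], so at most one full turn either way is needed. *)
  { assert (Hcase : exists d, - (theta m / 2) < PI / 2 - a + d <= 2 * PI - theta m / 2
                    /\ (d = 0 \/ d = 2 * PI \/ d = - (2 * PI))).
    { destruct (Rle_lt_dec (PI / 2 - a) (- (theta m / 2))).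
      - exists (2 * PI). split; [lra|auto].
      - destruct (Rle_lt_dec (PI / 2 - a) (2 * PI - theta m / 2)).
        + exists 0. split; [lra|auto].
        + exists (- (2 * PI)). split; [lra|auto]. }
    destruct Hcase as (d & Hd & Hd').
    exists (PI / 2 - a + d). split; [exact Hd|].
    replace (PI / 2 - (PI / 2 - a + d)) with (a - d) by ring.
    rewrite cos_minus, sin_minus.
    assert (cos d = 1 /\ sin d = 0) as [-> ->].
    { destruct Hd' as [->|[->| ->]].
      - now rewrite cos_0, sin_0.
      - now rewrite cos_2PI, sin_2PI.
      - rewrite cos_neg, sin_neg, cos_2PI, sin_2PI. lra. }
    lra. }
  destruct Hb as (b & Hb & Hbc & Hbs).
  (* Adding one half centres the unit intervals of [nat_ceil] at the bisectors. *)
  assert (Hx : (b / theta m + / 2) * theta m = b + theta m / 2) by (field; lra).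
  destruct (nat_ceil m (b / theta m + / 2)) as (j & Hj & Hjb).
  { split.
    - apply Rmult_lt_reg_r with (theta m); lra.
    - apply Rmult_le_reg_r with (theta m); lra. }
  exists j, (b - INR j * theta m).
  replace (PI / 2 - INR j * theta m - (b - INR j * theta m)) with (PI / 2 - b) by ring.
  rewrite Hbc, Hbs. split; [exact Hj|]. split; [|split; assumption].
  destruct Hjb as [Hj1 Hj2].
  apply (Rmult_lt_compat_r (theta m)) in Hj1; [|exact Ht].
  apply (Rmult_le_compat_r (theta m)) in Hj2; [|lra].
  lra.
Qed.

(** The angle is written with [+ - s] so that [cone_change_angle] applies to it with [- s] for its
    deviation. *)
Lemma dot_cross_polar (m i j : nat) (s : R) (z : point) :
  fst z = norm z * cos (PI / 2 - INR j * theta m - s) ->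
  snd z = norm z * sin (PI / 2 - INR j * theta m - s) ->
  dot z (bisector m i) = norm z * cos ((INR i - INR j) * theta m + - s) /\
  cross z (bisector m i) = norm z * - sin ((INR i - INR j) * theta m + - s).
Proof.
  intros Hc Hs. unfold dot, cross, bisector; simpl. rewrite Hc, Hs.
  replace ((INR i - INR j) * theta m + - s) with
    ((PI / 2 - INR j * theta m - s) - (PI / 2 - INR i * theta m)) by ring.
  set (a := PI / 2 - INR j * theta m - s). set (b := PI / 2 - INR i * theta m).
  rewrite cos_minus, sin_minus. split; ring.
Qed.

(** * Behaviour of the potential under a change of cone and under a move *)

Lemma next_cone (k i : nat) (v w : point) :
  let m := (4 * k + 5)%nat in
  (1 <= k)%nat -> (i < m)%nat -> v <> w ->
  (forall j, (j < m)%nat -> cross (vsub w v) (boundary_ray m j) <> 0) ->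
  0 <= dot (vsub w v) (bisector m i) ->
  exists j, (j < m)%nat /\ in_cone m v j w /\
    potential m j (vsub w v) <= potential m i (vsub w v).
Proof.
  intros m Hk Hi Hvw Hgp Hdot. pose proof PI_RGT_0.
  destruct (theta_bounds k Hk) as [Ht Ht5]. fold m in Ht, Ht5.
  pose proof (edist_pos v w Hvw) as Hr. rewrite edist_norm in Hr.
  destruct (cone_cover m (vsub w v)) as (j & s & Hj & Hs & Hz1 & Hz2); [lia|].
  set (z := vsub w v) in *.
  destruct (dot_cross_polar m i j s z Hz1 Hz2) as [Hdi Hci].
  destruct (dot_cross_polar m j j s z Hz1 Hz2) as [Hdj Hcj].
  replace ((INR j - INR j) * theta m + - s) with (- s) in Hdj, Hcj by ring.
  exists j. split; [exact Hj|]. split.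
  - unfold in_cone. fold z. rewrite edist_norm. fold z. rewrite Hdj, cos_neg.
    apply Rmult_lt_compat_l; [exact Hr|].
    (* The closed end of the sector is a boundary ray, which general position excludes; this gives
       the strict inequality of [in_cone]. *)
    assert (Hne : s <> theta m / 2).
    { intros ->. apply (Hgp j Hj).
      unfold cross. rewrite Hz1, Hz2. unfold boundary_ray; simpl.
      replace (PI / 2 - INR j * theta m - theta m / 2)
        with (PI / 2 - theta m / 2 - INR j * theta m) by ring. ring. }
    destruct (Rle_lt_dec 0 s).
    + apply cos_decreasing_1; lra.
    + rewrite <- (cos_neg s). apply cos_decreasing_1; lra.
  - destruct (cone_change_angle k i j (- s) Hi Hj) as (n & e & Hn & He & Hcn & Hsn).
    fold m in Hcn, Hsn.
    assert (Hcos : 0 <= cos (INR n * theta m + e)).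
    { rewrite <- Hcn. rewrite Hdi in Hdot. nra. }
    assert (Hse : - (theta m / 2) <= e <= theta m / 2) by (destruct He; subst; lra).
    pose proof (turn_le k n e Hk Hn Hse Hcos) as HT. fold m in HT. cbv zeta in HT.
    rewrite <- Hcn, <- Hsn in HT.
    (* Both quantities are even, so the possible reflection of [s] does not affect the potential in
       the new cone. *)
    assert (He' : cos e = cos (- s) /\ Rabs (sin e) = Rabs (sin (- s))).
    { destruct He as [->| ->]; [auto|].
      now rewrite (cos_neg (- s)), (sin_neg (- s)), Rabs_Ropp. }
    destruct He' as [He1 He2]. rewrite He1, He2 in HT.
    unfold potential. rewrite Hdi, Hci, Hdj, Hcj, !Rabs_mult, !Rabs_Ropp.
    rewrite (Rabs_right (norm z)) by lra.
    nra.
Qed.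

(** The sum of two facts about the cone: [r <= y / cos (theta / 2)], and [c] times
    [|x| <= y tan (theta / 2)]. *)
Lemma in_cone_norm_le (k i : nat) (u v : point) :
  let m := (4 * k + 5)%nat in
  (1 <= k)%nat -> in_cone m u i v ->
  edist u v <= coef_A (theta m) * dot (vsub v u) (bisector m i)
               - coef_c (theta m) * Rabs (cross (vsub v u) (bisector m i)).
Proof.
  intros m Hk Hin. unfold in_cone in Hin. rewrite edist_norm in *.
  pose proof PI_RGT_0.
  destruct (theta_bounds k Hk) as [Ht Ht5]. fold m in Ht, Ht5.
  pose proof (dot_cross_sqr m i (vsub v u)) as Hsq.
  pose proof (norm_nonneg (vsub v u)) as Hr.
  pose proof (coef_c_pos _ Ht Ht5) as Hcp.
  set (y := dot _ _) in *. set (x := cross _ _) in *. set (r := norm _) in *.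
  unfold coef_A, tan.
  assert (HC : 0 < cos (theta m / 2)) by (apply cos_gt_0; lra).
  assert (HS : 0 < sin (theta m / 2)) by (apply sin_gt_0; lra).
  pose proof (sin2_cos2 (theta m / 2)) as H1. unfold Rsqr in H1.
  set (C := cos _) in *. set (S := sin _) in *. set (c := coef_c _) in *.
  assert (HrC : 0 <= r * C) by (apply Rmult_le_pos; lra).
  (* In squares: [x^2 C^2 = r^2 C^2 - y^2 C^2 <= y^2 - y^2 C^2 = y^2 S^2]. *)
  assert (Hx : Rabs x * C <= y * S).
  { apply Rsqr_incr_0_var; [|nra].
    rewrite !Rsqr_mult, <- Rsqr_abs. unfold Rsqr.
    assert ((r * C) * (r * C) <= y * y) by (apply Rmult_le_compat; nra).
    nra. }
  apply Rmult_le_reg_r with C; [exact HC|].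
  replace (((/ C + c * (S / C)) * y - c * Rabs x) * C)
    with (y + c * (y * S - Rabs x * C)) by (field; lra).
  nra.
Qed.

(** Coordinates along the bisector add; across it, the triangle inequality costs at most [c |x|] of
    [v - u], which the negative term of [in_cone_norm_le] pays for. *)
Lemma potential_step (k i : nat) (u v w : point) :
  let m := (4 * k + 5)%nat in
  (1 <= k)%nat -> in_cone m u i v ->
  edist u v + potential m i (vsub w v) <= potential m i (vsub w u).
Proof.
  intros m Hk Hin. pose proof (in_cone_norm_le k i u v Hk Hin) as Hle.
  fold m in Hle. destruct (theta_bounds k Hk) as [Ht Ht5]. fold m in Ht, Ht5.
  pose proof (coef_c_pos _ Ht Ht5) as Hcp.
  unfold potential.
  replace (dot (vsub w u) (bisector m i)) with
    (dot (vsub w v) (bisector m i) + dot (vsub v u) (bisector m i))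
    by (unfold dot, vsub; simpl; ring).
  assert (Rabs (cross (vsub w v) (bisector m i)) <=
          Rabs (cross (vsub w u) (bisector m i)) +
          Rabs (cross (vsub v u) (bisector m i))).
  { replace (cross (vsub w v) (bisector m i)) with
      (cross (vsub w u) (bisector m i) - cross (vsub v u) (bisector m i))
      by (unfold cross, vsub; simpl; ring).
    unfold Rminus. eapply Rle_trans; [apply Rabs_triang|].
    rewrite Rabs_Ropp. lra. }
  nra.
Qed.

(** This is [potential_step] with [v = w], where the remaining potential is zero. *)
Lemma edist_le_potential (k i : nat) (u w : point) :
  (1 <= k)%nat -> in_cone (4 * k + 5) u i w ->
  edist u w <= potential (4 * k + 5) i (vsub w u).
Proof.
  intros Hk Hin. pose proof (potential_step k i u w w Hk Hin) as H.
  cbv zeta in H. unfold potential at 1 in H.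
  replace (dot (vsub w w) _) with 0 in H by (unfold dot, vsub; simpl; ring).
  replace (cross (vsub w w) _) with 0 in H by (unfold cross, vsub; simpl; ring).
  rewrite Rabs_R0 in H. lra.
Qed.

(** * Minima over finite lists and strictness of cones *)

Lemma list_argmin (T : Type) (Q : T -> Prop) (f : T -> R) (l : list T) (w : T) :
  (forall x, Q x \/ ~ Q x) -> In w l -> Q w ->
  exists v, In v l /\ Q v /\ forall x, In x l -> Q x -> f v <= f x.
Proof.
  intros Hdec. revert w. induction l as [|a l IH]; intros w Hw HQ; [destruct Hw|].
  (* Even when [w] is the head, the tail may hold candidates; the induction hypothesis applies
     exactly when it does. *)
  assert (Hl : (exists x, In x l /\ Q x) \/ ~ (exists x, In x l /\ Q x)).
  { clear -Hdec. induction l as [|b l IH].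
    - right. now intros (x & [] & _).
    - destruct (Hdec b) as [Hb|Hb]; [left; exists b; simpl; auto|].
      destruct IH as [(x & Hx & HQ)|IH]; [left; exists x; simpl; auto|].
      right. intros (x & [->|Hx] & HQ); [auto|apply IH; eauto]. }
  destruct Hl as [(x & Hx & HQx)|Hnone].
  - destruct (IH x Hx HQx) as (v & Hv & HQv & Hmin).
    destruct (Hdec a) as [Ha|Ha].
    + destruct (Rle_lt_dec (f a) (f v)).
      * exists a. split; [now left|split; [exact Ha|]].
        intros y [->|Hy] HQy; [lra|]. specialize (Hmin y Hy HQy). lra.
      * exists v. split; [now right|split; [exact HQv|]].
        intros y [<-|Hy] HQy; [lra|auto].
    + exists v. split; [now right|split; [exact HQv|]].
      intros y [<-|Hy] HQy; [contradiction|auto].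
  - destruct Hw as [->|Hw]; [|exfalso; eauto].
    exists w. split; [now left|split; [exact HQ|]].
    intros y [->|Hy] HQy; [lra|exfalso; eauto].
Qed.

Lemma in_cone_dec (m i : nat) (u v : point) : in_cone m u i v \/ ~ in_cone m u i v.
Proof.
  unfold in_cone.
  destruct (Rgt_dec (dot (vsub v u) (bisector m i)) (edist u v * cos (theta m / 2)));
    auto.
Qed.

(** Strictness of [in_cone] excludes the apex, so a greedy move really leaves its point. *)
Lemma not_in_cone_self (m i : nat) (u : point) : ~ in_cone m u i u.
Proof.
  unfold in_cone, edist, dot, vsub; simpl.
  replace ((fst u - fst u) * (fst u - fst u) + (snd u - snd u) * (snd u - snd u))
    with 0 by ring.
  rewrite sqrt_0. lra.
Qed.

(** Every greedy edge then lowers the potential by at least [d], which makes the routing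
    terminate. *)
Lemma min_distance (l : list point) :
  exists d, 0 < d /\ forall p q, In p l -> In q l -> p <> q -> d <= edist p q.
Proof.
  assert (Hone : forall (p : point) l, exists d, 0 < d /\
    forall q, In q l -> p <> q -> d <= edist p q /\ d <= edist q p).
  { intros p. clear l. induction l as [|a l (d & Hd & IH)].
    - exists 1. split; [lra|now intros q []].
    - destruct (Req_dec (edist p a) 0) as [Hz|Hz].
      + exists d. split; [exact Hd|]. intros q [->|Hq] Hpq; [|now apply IH].
        apply edist_pos in Hpq. lra.
      + assert (Hp : 0 < edist p a).
        { pose proof (sqrt_pos (dot (vsub p a) (vsub p a))).
          unfold edist in *. lra. }
        assert (Hsym : edist a p = edist p a)
          by (rewrite edist_norm; reflexivity).
        exists (Rmin d (edist p a)). split; [now apply Rmin_glb_lt|].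
        pose proof (Rmin_l d (edist p a)). pose proof (Rmin_r d (edist p a)).
        intros q [<-|Hq] Hpq; [lra|]. specialize (IH q Hq Hpq). lra. }
  induction l as [|a l (d & Hd & IH)].
  - exists 1. split; [lra|now intros p q []].
  - destruct (Hone a l) as (e & He & Ha).
    exists (Rmin d e). split; [now apply Rmin_glb_lt|].
    pose proof (Rmin_l d e). pose proof (Rmin_r d e).
    intros p q [<-|Hp] [<-|Hq] Hpq.
    + congruence.
    + specialize (Ha q Hq Hpq). lra.
    + assert (a <> p) as Hap by congruence. specialize (Ha p Hp Hap). lra.
    + specialize (IH p q Hp Hq Hpq). lra.
Qed.

(** * Greedy routing *)

Lemma greedy_path (k : nat) (P : list point) (w : point) :
  let m := (4 * k + 5)%nat in
  (1 <= k)%nat -> general_position m P -> In w P ->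
  forall u i, In u P -> (i < m)%nat -> in_cone m u i w ->
  exists l, hd_error l = Some u /\ last l u = w /\ is_walk m P l /\
    walk_length l <= potential m i (vsub w u).
Proof.
  intros m Hk [Hgp _] Hw.
  destruct (min_distance P) as (d & Hd & Hmin).
  (* Induction on the potential in units of [d], for all [u] and [i] since a move changes both. *)
  assert (Hind : forall n u i, In u P -> (i < m)%nat -> in_cone m u i w ->
    potential m i (vsub w u) <= INR n * d ->
    exists l, hd_error l = Some u /\ last l u = w /\ is_walk m P l /\
      walk_length l <= potential m i (vsub w u)).
  { induction n as [|n IH]; intros u i Hu Hi Hin Hpot.
    (* A potential of at most zero contradicts [0 < |uw| <= potential]. *)
    - exfalso. pose proof (edist_le_potential k i u w Hk Hin) as Hle. fold m in Hle.
      assert (u <> w) as Huw by (intros ->; exact (not_in_cone_self _ _ _ Hin)).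
      apply edist_pos in Huw. simpl in Hpot. lra.
    - destruct (list_argmin point (in_cone m u i) (proj m u i) P w
                  (in_cone_dec m i u) Hw Hin) as (v & Hv & Hvin & Hvmin).
      assert (Hadj : theta_adj m P u v).
      { left. split; [exact Hu|split; [exact Hv|]]. exists i. auto. }
      assert (Hpt : {v = w} + {v <> w}).
      { destruct v as [a b], w as [a' b'].
        destruct (Req_EM_T a a'), (Req_EM_T b b');
          [left; now subst|right; congruence ..]. }
      destruct Hpt as [->|Hvw].
      + exists (u :: w :: nil). simpl. repeat split; auto.
        pose proof (edist_le_potential k i u w Hk Hin) as Hle. fold m in Hle. lra.
      + pose proof (potential_step k i u v w Hk Hvin) as Hstep. fold m in Hstep.
        cbv zeta in Hstep.
        assert (Huv : u <> v) by (intros ->; exact (not_in_cone_self _ _ _ Hvin)).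
        pose proof (Hmin u v Hu Hv Huv) as Hduv.
        (* [w] competed with [v] for the smallest projection, so it does not lie behind [v]; this
           gives [f <= PI / 2]. *)
        assert (Hdot : 0 <= dot (vsub w v) (bisector m i)).
        { specialize (Hvmin w Hw Hin). unfold proj in Hvmin.
          replace (dot (vsub w v) (bisector m i)) with
            (dot (vsub w u) (bisector m i) - dot (vsub v u) (bisector m i))
            by (unfold dot, vsub; simpl; ring). lra. }
        destruct (next_cone k i v w Hk Hi Hvw) as (j & Hj & Hjin & Hjpot).
        { intros j Hj. now apply Hgp. }
        { exact Hdot. }
        fold m in Hj, Hjin, Hjpot.
        destruct (IH v j Hv Hj Hjin) as (l & Hhd & Hlast & Hwalk & Hlen).
        { rewrite S_INR in Hpot. lra. }
        destruct l as [|v' l]; [discriminate|].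
        simpl in Hhd. injection Hhd as ->.
        exists (u :: v :: l). split; [reflexivity|]. split.
        (* On a nonempty list the default of [last] is irrelevant, so [u] may be replaced by [v]. *)
        { rewrite <- Hlast. clear. change (last (v :: l) u = last (v :: l) v).
          revert v. induction l as [|a l IHl]; intros v; [reflexivity|].
          simpl. destruct l; [reflexivity|]. exact (IHl v). }
        split; [split; assumption|].
        change (edist u v + walk_length (v :: l) <= potential m i (vsub w u)).
        lra. }
  intros u i Hu Hi Hin.
  destruct (INR_archimed d (potential m i (vsub w u)) Hd) as [n Hn].
  apply (Hind n u i Hu Hi Hin). lra.
Qed.

(** * The stretch factor as a potential *)

(** As [uM] runs along the bisector, [cos alpha = y / r]; the angle is unsigned, so
    [sin alpha = |x| / r]. *)
Lemma stretch_factor_potential (m i : nat) (u w : point) :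
  u <> w -> 0 < proj m u i w ->
  stretch_factor m (alpha_angle m u i w) * edist u w = potential m i (vsub w u).
Proof.
  intros Huw Hp. pose proof (edist_pos u w Huw) as Hr.
  rewrite edist_norm in *.
  pose proof (bisector_unit m i) as Hb. pose proof (dot_cross_sqr m i (vsub w u)) as Hsq.
  assert (Ha : alpha_angle m u i w = acos (proj m u i w / norm (vsub w u))).
  { unfold alpha_angle, vangle. fold (norm (vsub w u)). f_equal.
    set (M := vsub (canon_mid m u i w) u).
    assert (HM : M = (proj m u i w * fst (bisector m i), proj m u i w * snd (bisector m i)))
      by (unfold M, canon_mid, vsub; simpl; f_equal; ring).
    assert (H1 : dot M M = proj m u i w * proj m u i w).
    { rewrite HM. unfold dot. cbn [fst snd].
      transitivity (proj m u i w * proj m u i w *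
        (fst (bisector m i) * fst (bisector m i) + snd (bisector m i) * snd (bisector m i)));
        [ring|]. rewrite Hb. ring. }
    (* [M] is the foot of the perpendicular from [w], so both products equal the squared projection
       and the quotient reduces to [proj / r]. *)
    assert (H2 : dot (vsub w u) M = proj m u i w * proj m u i w).
    { rewrite HM.
      transitivity (proj m u i w * dot (vsub w u) (bisector m i)); [|reflexivity].
      unfold dot at 1 2. cbn [fst snd]. ring. }
    rewrite H1, H2, sqrt_square by lra. field. lra. }
  rewrite Ha. unfold proj in *. set (y := dot _ _) in *.
  set (x := cross _ _) in *. set (r := norm _) in *.
  assert (Hyr : -1 <= y / r <= 1).
  { split; apply Rmult_le_reg_r with r; auto; unfold Rdiv;
      rewrite Rmult_assoc, Rinv_l by lra; nra. }
  assert (Hc : cos (acos (y / r)) * r = y)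
    by (rewrite cos_acos by lra; field; lra).
  assert (Hs : sin (acos (y / r)) * r = Rabs x).
  { pose proof (acos_bound (y / r)). apply Rsqr_inj.
    - apply Rmult_le_pos; [apply sin_ge_0; lra|lra].
    - apply Rabs_pos.
    - rewrite <- Rsqr_abs, Rsqr_mult, sin2, cos_acos by lra. unfold Rsqr.
      replace ((1 - y / r * (y / r)) * (r * r)) with (r * r - y * y) by (field; lra).
      lra. }
  unfold stretch_factor, potential, coef_A, coef_c, Rdiv. fold x y.
  fold (y / r). set (a := acos (y / r)) in *. clearbody a.
  rewrite <- Hs, <- Hc. ring.
Qed.

Theorem mainTheorem12 (k : nat) (P : list point) (u w : point) (i : nat) :
  (1 <= k)%nat ->
  NoDup P ->
  general_position (4 * k + 5) P ->
  In u P -> In w P -> u <> w ->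
  (i < 4 * k + 5)%nat ->
  in_cone (4 * k + 5) u i w ->
  exists l : list point,
    hd_error l = Some u /\ last l u = w /\
    is_walk (4 * k + 5) P l /\
    walk_length l <=
      stretch_factor (4 * k + 5) (alpha_angle (4 * k + 5) u i w) * edist u w.
Proof.
  intros Hk _ Hgp Hu Hw Huw Hi Hin.
  rewrite stretch_factor_potential; [now apply greedy_path|exact Huw|].
  (* Since [theta / 2 < PI / 2], lying in the cone forces a positive projection. *)
  pose proof PI_RGT_0. destruct (theta_bounds k Hk) as [Ht Ht5].
  pose proof (edist_pos u w Huw).
  assert (0 < cos (theta (4 * k + 5) / 2)) by (apply cos_gt_0; lra).
  unfold in_cone in Hin. unfold proj. nra.
Qed.
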